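(* Let $m,n\ge 2$, let $A\le \mathcal{S}_m$ and $B\le \mathcal{S}_n$ be subgroups. Then for every $k\in\{0,1,\dots,mn\}$ $$\delta_k(A\wr_I B)=\sum_{\ell=0}^n \delta_\ell(B)\sum_{j_1+\dots+j_\ell=k}\ \prod_{r=1}^{\ell}\delta_{j_r}(A),\qquad\text{and so}\qquad \delta(A\wr_I B)=\sum_{\ell=0}^n\delta_\ell(B)\,\delta(A)^\ell;$$ and for every $k\in\{0,1,\dots,m^n\}$ $$\delta_k(A\wr_P B)=\frac{1}{|B|}\sum_{\ell=1}^n\genfrac{[}{]}{0pt}{}{B}{\ell}\sum_{j_1\cdots j_\ell=k}\ \prod_{r=1}^{\ell}\delta_{j_r}(A),\qquad\text{and}\qquad \delta(A\wr_P B)=1-\frac{1}{|B|}\sum_{\ell=1}^n\genfrac{[}{]}{0pt}{}{B}{\ell}(1-\delta(A))^\ell .$$ Here the inner sums run over all $\ell$-tuples $(j_1,\dots,j_\ell)\in\{0,1,\dots,m\}^\ell$ with $j_1+\dots+j_\ell=k$, respectively $j_1\cdots j_\ell=k$.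
   Context: $\mathcal{S}_n$ is the symmetric group on $[n]=\{1,\dots,n\}$; permutations act on the right, $x\mapsto xg$. For a finite group $G$ acting on a finite set $X$ and an integer $k\ge 0$, $\delta_k(G)=\delta_k(G,X)$ is the proportion of elements of $G$ having exactly $k$ fixed points in $X$, and $\delta(G)=\delta_0(G)$ (the proportion of derangements). Subgroups of $\mathcal{S}_n$ act naturally on $[n]$. For $B\le\mathcal{S}_n$, $\genfrac{[}{]}{0pt}{}{B}{\ell}$ is the number of elements of $B$ with exactly $\ell$ cycles in their disjoint cycle decomposition (fixed points counted as cycles). For $A\le\mathcal{S}_m$, $B\le\mathcal{S}_n$, the wreath product $A\wr B=A^{[n]}\rtimes B$ has underlying set $A^{[n]}\times B$ ($A^{[n]}$ being the group of functions $[n]\to A$ under pointwise multiplication) and multiplication $(\alpha,b)(\beta,c)=(\alpha\beta^{b^{-1}},bc)$, where $\beta^{b}(y)=\beta(yb^{-1})$. $A\wr_I B$ denotes $A\wr B$ acting on $[m]\times[n]$ by $(x,y)(\alpha,b)=(x\alpha(y),yb)$ (imprimitive action). $A\wr_P B$ denotes $A\wr B$ acting on the set $[m]^{[n]}$ of functions $\omega\colon[n]\to[m]$ by $(\omega(\alpha,b))(y)=\omega(yb^{-1})\alpha(yb^{-1})$ (power action). Conventions: for $\ell=0$ the only tuple is the empty one, with sum $0$ and empty product $1$; $0^0=1$. *)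

(* Defs.v *)
From HB Require Import structures.
From mathcomp Require Import all_boot all_order all_algebra all_fingroup.

Set Implicit Arguments.
Unset Strict Implicit.
Unset Printing Implicit Defensive.

Import GroupScope GRing.Theory.

Definition delta (aT : finGroupType) (rT : finType)
    (to : {action aT &-> rT}) (G : {group aT}) (k : nat) : rat :=
  (#|[set g in G | #|'Fix_to[g]| == k]|%:R / #|G|%:R)%R.

(* [porbits] lists the fixed points of b as singleton cycles. *)
Definition num_cycles (I : finType) (B : {set {perm I}}) (l : nat) : nat :=
  #|[set b in B | #|porbits b| == l]|.

(* The full wreath product {perm T} wr {perm I}; the library's [sdprod_by] puts
   the acting factor on the other side, hence the explicit construction. *)
Record wreath (T I : finType) := Wreath {
  wr_base : {ffun I -> {perm T}};
  wr_top : {perm I}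
}.

Section WreathGroup.
Variables T I : finType.

Definition wreath_pair (u : wreath T I) := (wr_base u, wr_top u).
Definition pair_wreath (p : {ffun I -> {perm T}} * {perm I}) : wreath T I :=
  Wreath p.1 p.2.
Lemma wreath_pairK : cancel wreath_pair pair_wreath.
Proof. by case. Qed.

HB.instance Definition _ := Finite.copy (wreath T I) (can_type wreath_pairK).

(* Permutations act on the right, so s * t is s followed by t, and y b is
   written [b y]; the twisted factor beta^(b^-1) is y |-> beta (b y). *)
Definition wreath_mul (u v : wreath T I) : wreath T I :=
  Wreath [ffun y => wr_base u y * wr_base v (wr_top u y)] (wr_top u * wr_top v).

Definition wreath_one : wreath T I := Wreath [ffun=> 1] 1.

Definition wreath_inv (u : wreath T I) : wreath T I :=
  Wreath [ffun y => (wr_base u ((wr_top u)^-1 y))^-1] (wr_top u)^-1.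

Lemma wreath_mulA : associative wreath_mul.
Proof.
move=> [a1 b1] [a2 b2] [a3 b3]; rewrite /wreath_mul /= mulgA; congr Wreath.
by apply/ffunP=> y; rewrite !ffunE permM mulgA.
Qed.

Lemma wreath_mul1 : left_id wreath_one wreath_mul.
Proof.
move=> [a b]; rewrite /wreath_mul /= mul1g; congr Wreath.
by apply/ffunP=> y; rewrite !ffunE perm1 mul1g.
Qed.

Lemma wreath_mulV : left_inverse wreath_one wreath_inv wreath_mul.
Proof.
move=> [a b]; rewrite /wreath_mul /= mulVg; congr Wreath.
by apply/ffunP=> y; rewrite !ffunE mulVg.
Qed.

HB.instance Definition _ :=
  Finite_isGroup.Build (wreath T I) wreath_mulA wreath_mul1 wreath_mulV.

Section WreathSubgroup.
Variables (A : {group {perm T}}) (B : {group {perm I}}).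

Definition wreath_set : {set wreath T I} :=
  [set u | [forall y, wr_base u y \in A] && (wr_top u \in B)].

Lemma wreath_group_set : group_set wreath_set.
Proof.
apply/group_setP; split=> [|u v]; rewrite !inE.
  by rewrite group1 andbT; apply/forallP=> y; rewrite ffunE.
case/andP=> /forallP Au Bu /andP[/forallP Av Bv].
rewrite groupM // andbT; apply/forallP=> y.
by rewrite ffunE groupM.
Qed.

Canonical wreath_group := Group wreath_group_set.

End WreathSubgroup.

Definition imprim_fun (p : T * I) (u : wreath T I) : T * I :=
  (wr_base u p.2 p.1, wr_top u p.2).

Lemma imprim_fun1 : imprim_fun^~ 1 =1 id.
Proof. by move=> [x y]; rewrite /imprim_fun /= ffunE !perm1. Qed.

Lemma imprim_funM : forall p, act_morph imprim_fun p.
Proof. by move=> [x y] u v; rewrite /imprim_fun /= ffunE !permM. Qed.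

Definition imprim_action : {action (wreath T I) &-> (T * I)%type} :=
  TotalAction imprim_fun1 imprim_funM.

Definition power_fun (w : {ffun I -> T}) (u : wreath T I) : {ffun I -> T} :=
  [ffun y => wr_base u ((wr_top u)^-1 y) (w ((wr_top u)^-1 y))].

Lemma power_fun1 : power_fun^~ 1 =1 id.
Proof.
by move=> w; apply/ffunP=> y; rewrite ffunE /= invg1 ffunE !perm1.
Qed.

Lemma power_funM : forall w, act_morph power_fun w.
Proof.
move=> w u v; apply/ffunP=> y; rewrite !ffunE /= invMg !permM.
by rewrite permKV.
Qed.

Definition power_action : {action (wreath T I) &-> {ffun I -> T}} :=
  TotalAction power_fun1 power_funM.

End WreathGroup.

(* Main.v *)
(* For each b in B, the number of fixed points of (alpha, b) is given by fixed
   point counts of independent uniform elements of A. In the imprimitive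
   action it is the sum of fix (alpha y) over the fixed points y of b. In the
   power action a fixed function is determined by its value at one root of
   each cycle of b, and this value must be fixed by the product of alpha along
   the cycle; so the number is the product over the cycles of the fixed point
   counts of the cycle products. Replacing alpha by the cycle product at each
   root is an injective map of A^n to itself, so the cycle products are again
   independent and uniform in A. *)
Require Import Defs.
From HB Require Import structures.
From mathcomp Require Import all_boot all_order all_algebra all_fingroup.

Set Implicit Arguments.
Unset Strict Implicit.

Import GRing.Theory.

Local Open Scope ring_scope.

(** * Counting by fibres and expanding powers of sums *)

Lemma card_groupR_neq0 (gT : finGroupType) (G : {group gT}) :
  #|G|%:R != 0 :> rat.
Proof. by rewrite Num.Theory.pnatr_eq0 -lt0n cardG_gt0. Qed.

Lemma sum_card_fibers (aT : finType) (D : {set aT}) (f : aT -> nat) n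
    (G : nat -> rat) :
    (forall x, f x <= n)%N ->
  \sum_(x in D) G (f x)
    = \sum_(0 <= l < n.+1) #|[set x in D | f x == l]|%:R * G l.
Proof.
move=> fn; rewrite big_mkord.
rewrite (partition_big (fun x => inord (f x) : 'I_n.+1) predT) //=.
apply: eq_bigr => l _; rewrite mulr_natl -sumr_const.
apply: eq_big => x; rewrite ?inE -val_eqE /= inordK ?ltnS //.
by case/andP=> _ /eqP ->.
Qed.

(** Distributivity, with tuples in place of functions on ['I_l]. It gives the closed forms for
    derangements. *)
Lemma sum_tuple_all (m l : nat) (P : pred 'I_m.+1) (f : 'I_m.+1 -> rat) :
  \sum_(j : l.-tuple 'I_m.+1 | [forall r, P (tnth j r)])
      \prod_(r < l) f (tnth j r)
    = (\sum_(x | P x) f x) ^+ l.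
Proof.
rewrite -[l in RHS]card_ord -prodr_const bigA_distr_big /=.
rewrite (reindex (fun j : l.-tuple 'I_m.+1 => [ffun r => tnth j r])) /=.
  by apply: eq_big => [j | j _]; [apply/forallP/ffun_onP => h r; have := h r |
    apply: eq_bigr => r _]; rewrite ffunE.
exists (fun f : {ffun 'I_l -> 'I_m.+1} => [tuple f r | r < l]) => [j _|g _].
  by apply: eq_from_tnth => r; rewrite tnth_mktuple ffunE.
by apply/ffunP => r; rewrite ffunE tnth_mktuple.
Qed.

(** * Fixed points of a single element of the wreath product *)

Section FixedPointCounts.

Local Open Scope group_scope.
Variables T I : finType.
Local Notation imprim := (imprim_action T I).
Local Notation power := (power_action T I).
Implicit Types (b : {perm I}) (u : wreath T I) (al : {ffun I -> {perm T}}).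

Lemma card_fix_imprim u :
  #|'Fix_imprim[u]|
    = (\sum_(y in 'Fix_'P[wr_top u]) #|'Fix_'P[wr_base u y]|)%N.
Proof.
under [RHS]eq_bigr => y _ do rewrite -sum1_card.
rewrite pair_big_dep -sum1_card /=.
rewrite (reindex (fun p : I * T => (p.2, p.1))) /=; last first.
  by exists (fun p => (p.2, p.1)) => -[].
apply: eq_bigl => -[y x] /=; apply/afix1P/andP => /=.
  by case=> fx fy; split; apply/afix1P; rewrite /= apermE -?[RHS]fx ?fy.
case=> /afix1P /= fy /afix1P /= fx; rewrite !apermE in fx fy.
by rewrite /imprim_fun /= fx fy.
Qed.

(** [froot] selects one point in each orbit of [b], so these points index the cycles. *)
Definition cycle_roots b : {set I} := [set y | froots b y].

Lemma fconnect_porbit b x y : fconnect b x y = (y \in porbit b x).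
Proof.
apply/idP/porbitP => [/iter_findex <- | [i ->]].
  by exists (findex b x y); rewrite permX.
by rewrite permX fconnect_iter.
Qed.

Lemma card_cycle_roots b : #|cycle_roots b| = #|porbits b|.
Proof.
have symb : connect_sym (frel b) by apply/fconnect_sym/perm_inj.
rewrite -(card_in_imset (f := porbit b) (D := cycle_roots b)); last first.
  move=> x y; rewrite !inE /roots => /eqP rx /eqP ry /eqP.
  rewrite eq_porbit_mem -fconnect_porbit symb -(root_connect symb) rx ry.
  by move/eqP.
apply: eq_card => X; apply/imsetP/imsetP => [[x _ ->] | [x _ ->]].
  by exists x.
exists (froot b x); first by rewrite inE roots_root.
by apply/eqP; rewrite eq_porbit_mem -fconnect_porbit symb connect_root.
Qed.

(** The factors come in the order in which [b] runs through the cycle from [y]: this is the effect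
    of one full turn on a value at [y]. *)
Definition cycle_prod b al y : {perm T} :=
  \prod_(i < fingraph.order b y) al (iter i b y).

Definition cycle_twist b al : {ffun I -> {perm T}} :=
  [ffun y => if y \in cycle_roots b then cycle_prod b al y else al y].

(** Two roots on one cycle coincide, so [iter i b r] would equal [r]; below the order this forces
    [i = 0]. *)
Lemma cycle_roots_iter b r i : r \in cycle_roots b ->
  (0 < i < fingraph.order b r)%N -> iter i b r \notin cycle_roots b.
Proof.
have symb : connect_sym (frel b) by apply/fconnect_sym/perm_inj.
rewrite !inE => rr /andP[i_gt0 lt_i]; apply/negP => ri.
have : froot b r = froot b (iter i b r).
  by apply/eqP; rewrite (root_connect symb) fconnect_iter.
rewrite (eqP rr) (eqP ri) => e.
by have := findex_iter lt_i; rewrite -e findex0 => i0; rewrite -i0 in i_gt0.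
Qed.

(* [cycle_prod b al y] is [al y] times values of [al] at points that are not
   roots, which the twist leaves unchanged; hence [al y] can be recovered. *)
Lemma cycle_twist_inj b : injective (cycle_twist b).
Proof.
move=> al1 al2 e.
have off y : y \notin cycle_roots b -> al1 y = al2 y.
  by move=> ny; have /ffunP/(_ y) := e; rewrite !ffunE (negPf ny).
apply/ffunP => y; have [ry | /off//] := boolP (y \in cycle_roots b).
have /ffunP/(_ y) := e.
rewrite !ffunE ry /cycle_prod -orderSpred !big_ord_recl /=.
under eq_bigr => i _.
  rewrite off; first over.
  have := @cycle_roots_iter b y i.+1 ry; rewrite iterS; apply.
  by have := ltn_ord i; rewrite -ltnS orderSpred.
by move/mulIg.
Qed.

Lemma cycle_twist_in (A : {group {perm T}}) b al :
  (forall y, al y \in A) -> forall y, cycle_twist b al y \in A.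
Proof.
by move=> Aal y; rewrite ffunE; case: ifP => // _; apply: group_prod.
Qed.

(** For a fixed function the base entry at a point carries the value there to the value at the next
    point of the cycle; iterating, one value determines the function on its cycle. *)
Lemma fix_power_iter u (w : {ffun I -> T}) :
    w \in 'Fix_power[u] -> forall y i,
  w (iter i (wr_top u) y)
    = (\prod_(k < i) wr_base u (iter k (wr_top u) y)) (w y).
Proof.
move=> /afix1P /ffunP fw y; elim=> [|i IHi]; first by rewrite big_ord0 perm1.
by rewrite iterS -[in LHS]fw /power_fun ffunE permK IHi big_ord_recr permM.
Qed.

(* [t0] only serves to extend functions on the roots to all of [I]. *)
Lemma card_fix_power (t0 : T) u :
  #|'Fix_power[u]| =
    (\prod_(y in cycle_roots (wr_top u))
       #|'Fix_'P[cycle_twist (wr_top u) (wr_base u) y]|)%N.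
Proof.
set b := wr_top u; set al := wr_base u; set R := cycle_roots b.
have symb : connect_sym (frel b) by apply/fconnect_sym/perm_inj.
pose res (w : {ffun I -> T}) := [ffun y => if y \in R then w y else t0].
pose D := pfamily t0 R (fun y => 'Fix_'P[cycle_twist b al y]).
have rootR y : froot b y \in R by rewrite inE roots_root.
have con y : fconnect b (froot b y) y by rewrite symb connect_root.
have -> : #|'Fix_power[u]| = #|D|.
  (* Restriction to the roots maps the fixed functions bijectively onto [D]; injectivity comes from
     propagation along the cycles. *)
  rewrite -(card_in_imset (f := res) (D := 'Fix_power[u])); last first.
    move=> w1 w2 f1 f2 /ffunP e; apply/ffunP => y.
    rewrite -(iter_findex (con y)) !fix_power_iter //.
    by have := e (froot b y); rewrite !ffunE rootR => ->.
  apply: eq_card => v; apply/imsetP/pfamilyP => [[w fw ->] | [/supportP sv fv]].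
    split; first by apply/supportP => y /negPf Ry; rewrite ffunE Ry.
    move=> y Ry; apply/afix1P; rewrite /= apermE !ffunE Ry /cycle_prod.
    by rewrite -fix_power_iter // iter_order //; apply: perm_inj.
  (* The preimage of [v]: its value at the root is carried along the cycle as far as [y]. *)
  pose w := [ffun y =>
    (\prod_(k < findex b (froot b y) y) al (iter k b (froot b y)))
      (v (froot b y))].
  exists w; last first.
    apply/ffunP => y; rewrite !ffunE; case: ifP => [|/negbT Ry]; last exact: sv.
    by rewrite inE => /eqP ->; rewrite findex0 big_ord0 perm1.
  apply/afix1P/ffunP => z; rewrite -(permKV b z) /= /power_fun ffunE -/b permK.
  move: (b^-1 z) => y; rewrite !ffunE -/al.
  have -> : froot b (b y) = froot b y.
    by apply/eqP; rewrite (root_connect symb) symb fconnect1.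
  set r := froot b y; have cy : fconnect b r y := con y.
  rewrite -[in al y](iter_findex cy) -[in b y](iter_findex cy) -iterS -permM.
  rewrite -(big_ord_recr (findex b r y) (fun k => al (iter k b r))) /=.
  (* Either the cycle has not yet closed at [b y], and both sides are the same partial product, or
     [b y] is the root, and the equation says that the cycle product fixes [v r]. *)
  have := findex_max cy; rewrite leq_eqVlt => /orP[/eqP e | lt_k]; last first.
    by rewrite -iterS findex_iter.
  rewrite -iterS e iter_order ?findex0 ?big_ord0 ?perm1; last exact: perm_inj.
  have /afix1P := fv r (rootR y); rewrite /= apermE ffunE rootR /cycle_prod.
  by [].
by rewrite card_pfamily foldrE big_map big_enum.
Qed.

End FixedPointCounts.

(** * Averaging over the base group, then over [B] *)

Section Wreath.

Variables (T I : finType) (m : nat) (leTm : (#|T| <= m)%N).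
Variables (A : {group {perm T}}) (B : {group {perm I}}).

Let dA := delta 'P%act A.
Let nfix (a : {perm T}) := #|'Fix_'P[a]%g|.

Lemma delta_sum1 : \sum_(j < m.+1) dA j = 1.
Proof.
rewrite /dA /delta -mulr_suml -natr_sum.
suff -> : (\sum_(j < m.+1) #|[set g in A | nfix g == j]| = #|A|)%N.
  by rewrite mulfV ?card_groupR_neq0.
rewrite -[in RHS]sum1_card.
rewrite (partition_big (fun g => inord (nfix g) : 'I_m.+1) predT) //=.
apply: eq_bigr => j _; rewrite -sum1_card; apply: eq_bigl => g; rewrite inE.
congr andb; rewrite -val_eqE /= inordK // ltnS.
exact: leq_trans (max_card _) leTm.
Qed.

(** The entries of [al] are chosen independently: a prescribed fixed point count at each point of
    [R], any element of [A] elsewhere. *)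
Lemma card_fix_profile (R : {set I}) (j : #|R|.-tuple 'I_m.+1) :
  #|[set al : {ffun I -> {perm T}} | (al \in ffun_on A) &&
      [forall i, nfix (al (enum_val i)) == tnth j i]]|%:R
    = (#|A| ^ #|I|)%:R * \prod_(i < #|R|) dA (tnth j i).
Proof.
have cA := card_groupR_neq0 A.
(* [insub] supplies the membership proof needed to find the index of [y] in [R]. *)
pose F y : {set {perm T}} := if insub y : {? y | y \in R} is Some s then
  [set a in A | nfix a == tnth j (enum_rank_in (valP s) (val s))] else A.
have FR i : F (enum_val i) = [set a in A | nfix a == tnth j i].
  rewrite /F; case: insubP => [s _ es|]; last by rewrite enum_valP.
  by have -> : enum_rank_in (valP s) (val s) = i
    by apply: enum_val_inj; rewrite enum_rankK_in // (valP s).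
have FN y : y \notin R -> F y = A.
  by move=> /negPf yN; rewrite /F; case: insubP => // s; rewrite yN.
transitivity (#|family F|%:R : rat).
  congr _%:R; apply: eq_card => al; rewrite inE.
  apply/andP/familyP => [[/ffun_onP Aal /forallP h] y | h].
    have [yR | /FN ->] := boolP (y \in R); last exact: Aal.
    by rewrite -(enum_rankK_in yR yR) FR inE Aal h.
  split.
    apply/ffun_onP => y; have := h y.
    by rewrite /F; case: insub => // s; rewrite inE => /andP[].
  by apply/forallP => i; have := h (enum_val i); rewrite FR inE => /andP[].
rewrite card_family foldrE big_map big_enum /= natr_prod.
rewrite (bigID (mem R)) /= big_enum_val /=.
under eq_bigr => i _ do rewrite FR.
under [X in _ * X]eq_bigr => y yR do rewrite FN //.
rewrite prodr_const /dA /delta.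
have -> : (#|A| ^ #|I| = #|A| ^ #|R| * #|A| ^ #|[pred y | y \notin R]|)%N.
  by rewrite -expnD -(cardC R).
rewrite natrM !natrX mulrAC; congr (_ * _).
by rewrite prodf_div prodr_const card_ord mulrC divfK // expf_neq0.
Qed.

Variables (idx : nat) (op : Monoid.com_law idx).

(* [op] is addition for the imprimitive action, multiplication for the power
   action. *)
Definition tuple_delta l k : rat :=
  \sum_(j : l.-tuple 'I_m.+1 | \big[op/idx]_(r < l) (tnth j r : nat) == k)
    \prod_(r < l) dA (tnth j r).

(** The functions are sorted by their tuple of fixed point counts on [R]. *)
Lemma card_fix_distr (R : {set I}) k :
  #|[set al : {ffun I -> {perm T}} | (al \in ffun_on A) &&
      (\big[op/idx]_(y in R) nfix (al y) == k)]|%:R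
    = (#|A| ^ #|I|)%:R * tuple_delta #|R| k.
Proof.
rewrite /tuple_delta mulr_sumr.
under [RHS]eq_bigr => j _ do rewrite -card_fix_profile.
rewrite -natr_sum; congr _%:R; rewrite -sum1_card.
pose J (al : {ffun I -> {perm T}}) : #|R|.-tuple 'I_m.+1 :=
  [tuple inord (nfix (al (enum_val i))) | i < #|R|].
have JE al i : tnth (J al) i = nfix (al (enum_val i)) :> nat.
  rewrite tnth_mktuple inordK // ltnS; exact: leq_trans (max_card _) leTm.
have opJ al : \big[op/idx]_(r < #|R|) (tnth (J al) r : nat)
    = \big[op/idx]_(y in R) nfix (al y).
  by rewrite [RHS]big_enum_val; apply: eq_bigr => r _; rewrite JE.
pose Q (j : #|R|.-tuple 'I_m.+1) :=
  \big[op/idx]_(r < #|R|) (tnth j r : nat) == k.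
rewrite (partition_big J Q) /=; last first.
  by move=> al; rewrite inE /Q opJ => /andP[].
apply: eq_bigr => j jk; rewrite -[RHS]sum1_card.
apply: eq_bigl => al; rewrite !inE -andbA; congr andb.
apply/andP/forallP => [[_ /eqP <-] i | h].
  by rewrite JE.
have Jal : J al = j.
  by apply: eq_from_tnth => i; apply/val_inj; rewrite /= JE; apply/eqP.
by rewrite -opJ Jal; split=> //.
Qed.

Variables (rT : finType) (to : {action (wreath T I) &-> rT}).
Variables (h : {perm I} -> {ffun I -> {perm T}} -> {ffun I -> {perm T}}).
Variable (R : {perm I} -> {set I}).
Hypothesis h_inj : forall b, injective (h b).
Hypothesis h_in : forall b (al : {ffun I -> {perm T}}),
  (forall y, al y \in A) -> forall y, h b al y \in A.
Hypothesis fixE : forall u, #|'Fix_to[u]%g|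
  = \big[op/idx]_(y in R (wr_top u)) nfix (h (wr_top u) (wr_base u) y).

(** [h] is a change of coordinates on the base group, the identity or [cycle_twist]; since it
    permutes that group for each [b], the count can be made in the new coordinates. *)
Lemma delta_wreath k :
  delta to (wreath_group A B) k
    = #|B|%:R^-1 * \sum_(b in B) tuple_delta #|R b| k.
Proof.
have cA := card_groupR_neq0 A; have cB := card_groupR_neq0 B.
pose P b al := (al \in ffun_on A) && (\big[op/idx]_(y in R b) nfix (al y) == k).
have card_pairs (Q : {perm I} -> pred {ffun I -> {perm T}}) :
    #|[set u : wreath T I | (wr_top u \in B) && Q (wr_top u) (wr_base u)]|
      = (\sum_(b in B) #|[set al | Q b al]|)%N.
  under [RHS]eq_bigr => b _ do rewrite -sum1_card.
  rewrite pair_big_dep -sum1_card /=.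
  rewrite (reindex (fun p : {perm I} * _ => Wreath p.2 p.1)) /=.
    by apply: eq_bigl => p; rewrite !inE.
  by exists (fun u => (wr_top u, wr_base u)) => [[]|[]].
(* An injective self-map of a finite set is onto, which gives the converse of [h_in]. *)
have hA b al : (h b al \in ffun_on A) = (al \in ffun_on A).
  have sub : h b @: [set al in ffun_on A] \subset [set al in ffun_on A].
    apply/subsetP => _ /imsetP[x + ->]; rewrite !inE => /ffun_onP Ax.
    by apply/ffun_onP; apply: h_in.
  have /eqP eqh : h b @: [set al in ffun_on A] == [set al in ffun_on A].
    by rewrite eqEcard sub (card_imset _ (@h_inj b)) leqnn.
  have := mem_imset [set al in ffun_on A] al (@h_inj b).
  by rewrite eqh !inE.
have cardG : #|wreath_group A B| = (#|A| ^ #|I| * #|B|)%N.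
  rewrite mulnC -sum_nat_const -card_ffun_on.
  have := card_pairs (fun _ => ffun_on A).
  rewrite (eq_card (B := wreath_group A B)) => [->|u].
    by apply: eq_bigr => b _; apply: eq_card => al; rewrite inE.
  by rewrite !inE andbC.
rewrite /delta cardG natrM.
have -> : #|[set g in wreath_group A B | #|'Fix_to[g]%g| == k]|
    = (\sum_(b in B) #|[set al | P b al]|)%N.
  transitivity #|[set u | (wr_top u \in B)
      && P (wr_top u) (h (wr_top u) (wr_base u))]|.
    apply: eq_card => u; rewrite !inE fixE /P hA andbA; congr andb.
    exact: andbC.
  rewrite (card_pairs (fun b al => P b (h b al))); apply: eq_bigr => b _.
  rewrite -(card_imset _ (@h_inj b)); apply: eq_card => al; rewrite inE.
  apply/imsetP/idP => [[x + ->] | Pal]; first by rewrite inE.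
  have [g _ hg] := injF_bij (@h_inj b).
  by exists (g al); rewrite ?inE hg.
rewrite natr_sum; under eq_bigr => b _ do rewrite card_fix_distr.
by rewrite -mulr_sumr invfM mulrACA mulfV ?mul1r 1?mulrC // natrX expf_neq0.
Qed.

End Wreath.

(** * The formulas for the two actions *)

Arguments tuple_delta {T} m A {idx} op l k.

Theorem theorem1p1 (m n : nat) (hm : (2 <= m)%N) (hn : (2 <= n)%N)
    (A : {group 'S_m}) (B : {group 'S_n}) :
  let dA := delta 'P%act A in
  let dB := delta 'P%act B in
  let dI := delta (imprim_action 'I_m 'I_n) (wreath_group A B) in
  let dP := delta (power_action 'I_m 'I_n) (wreath_group A B) in
  [/\ forall k : nat, (k <= m * n)%N ->
        dI k = \sum_(0 <= l < n.+1) dB l *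
          \sum_(j : l.-tuple 'I_m.+1 | (\sum_(r < l) tnth j r == k)%N)
            \prod_(r < l) dA (tnth j r),
      dI 0%N = \sum_(0 <= l < n.+1) dB l * dA 0%N ^+ l,
      forall k : nat, (k <= m ^ n)%N ->
        dP k = (#|B|%:R)^-1 * \sum_(1 <= l < n.+1) (num_cycles B l)%:R *
          \sum_(j : l.-tuple 'I_m.+1 | (\prod_(r < l) tnth j r == k)%N)
            \prod_(r < l) dA (tnth j r)
    & dP 0%N = 1 - (#|B|%:R)^-1 *
          \sum_(1 <= l < n.+1) (num_cycles B l)%:R * (1 - dA 0%N) ^+ l].
Proof.
move=> dA dB dI dP; have cB := card_groupR_neq0 B.
have leIm : (#|'I_m| <= m)%N by rewrite card_ord.
have le_set (R : {set 'I_n}) : (#|R| <= n)%N.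
  by rewrite -[n in (_ <= n)%N]card_ord max_card.
have dIE k : dI k = \sum_(0 <= l < n.+1) dB l * tuple_delta m A addn l k.
  rewrite /dI (delta_wreath leIm B (op := addn) (h := fun _ => id)
    (R := fun b => 'Fix_'P[b]%g)) => [|b al1 al2|b al|u] //; last first.
    exact: card_fix_imprim.
  rewrite (sum_card_fibers B (f := fun b => #|'Fix_'P[b]%g|)
    (fun l => tuple_delta m A addn l k) (fun b => le_set _)).
  rewrite mulr_sumr; apply: eq_bigr => l _.
  by rewrite mulrA /dB /delta [_^-1 * _]mulrC.
(* Since [n] is positive, every permutation has a cycle; this removes the term [l = 0]. *)
have ncyc0 : num_cycles B 0 = 0%N.
  apply: eq_card0 => b; rewrite !inE; apply/andP => -[_].
  rewrite cards_eq0 => /eqP e.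
  have : porbit b (Ordinal (ltnW hn)) \in porbits b by apply: imset_f.
  by rewrite e inE.
have sum_cyc (G : nat -> rat) : \sum_(b in B) G #|cycle_roots b|
    = \sum_(1 <= l < n.+1) (num_cycles B l)%:R * G l.
  rewrite (sum_card_fibers B (f := fun b => #|cycle_roots b|) G
    (fun b => le_set _)).
  under eq_bigr => l _.
    have -> : #|[set x in B | #|cycle_roots x| == l]| = num_cycles B l.
      by apply: eq_card => b; rewrite !inE card_cycle_roots.
    over.
  by rewrite big_ltn // ncyc0 mul0r add0r.
have dPE k : dP k = #|B|%:R^-1 *
    \sum_(1 <= l < n.+1) (num_cycles B l)%:R * tuple_delta m A muln l k.
  rewrite /dP (delta_wreath leIm B (op := muln) (h := @cycle_twist _ _)
    (R := @cycle_roots _)) => [|b|b al|u].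
  - by rewrite (sum_cyc (fun l => tuple_delta m A muln l k)).
  - exact: cycle_twist_inj.
  - exact: cycle_twist_in.
  - exact: (card_fix_power (Ordinal (ltnW hm))).
split=> [k _||k _|] //.
- rewrite dIE; apply: eq_bigr => l _; congr (_ * _).
  (* A sum of naturals vanishes only if every term does, so only the zero tuple contributes. *)
  rewrite /tuple_delta (eq_bigl (fun j => [forall r, pred1 ord0 (tnth j r)])).
    by rewrite (sum_tuple_all l (pred1 ord0) (fun x => dA x)) big_pred1_eq.
  by move=> j; rewrite sum_nat_eq0.
rewrite dPE.
(* The leading 1 becomes an average over [B], so that the two sides can be compared for each [l]. *)
have cyc1 :
    #|B|%:R^-1 * \sum_(1 <= l < n.+1) (num_cycles B l)%:R * 1 = 1 :> rat.
  by rewrite -(sum_cyc (fun _ => 1)) sumr_const mulVf.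
rewrite -[X in X - _ * _]cyc1 -mulrBr -sumrB; congr (_ * _).
apply: eq_bigr => l _; rewrite -mulrBr; congr (_ * _).
have sum_nz : \sum_(j < m.+1 | j != ord0) dA j = 1 - dA 0%N.
  have := delta_sum1 leIm A; rewrite (bigD1 ord0) //= => <-.
  by rewrite [RHS]addrC addKr.
(* Both powers, [1 ^+ l] included, become sums over tuples: all tuples, and those without a zero
   entry. The difference runs over the tuples with product 0. *)
rewrite -sum_nz -(sum_tuple_all l _ (fun x => dA x)) -[X in X - _](expr1n _ l).
rewrite -[X in X ^+ l - _](delta_sum1 leIm A).
rewrite -(sum_tuple_all l predT).
apply/esym/eqP; rewrite subr_eq; apply/eqP.
rewrite (bigID (fun j : l.-tuple 'I_m.+1 => \prod_(r < l) tnth j r == 0)%N) /=.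
congr (_ + _); apply: eq_bigl => j.
  by rewrite (introT forallP).
rewrite (introT forallP) //= -lt0n.
rewrite (big_morph (leq 1) muln_gt0 (ltn0Sn 0)) big_andE.
by apply: eq_forallb => r; rewrite lt0n.
Qed.
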